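(* Let $G$ be a connected graph on $n$ vertices. Then $$\overline{S_1}(G)=2(n-1)W(G)-S_1(G)$$ and $$\overline{S_2}(G)=2\,(W(G))^2-\frac12\sum_{u\in V(G)}(\sigma_G(u))^2-S_2(G).$$
   Context: Graphs are finite and simple, with vertex set $V(G)$ and edge set $E(G)$. For a connected graph $G$, $d_G(u,v)$ is the shortest-path distance, the status of a vertex $u$ is $\sigma_G(u)=\sum_{v\in V(G)}d_G(u,v)$, and the Wiener index is $W(G)=\sum_{\{u,v\}\subseteq V(G)}d_G(u,v)=\frac12\sum_{u\in V(G)}\sigma_G(u)$. The status connectivity indices are $S_1(G)=\sum_{uv\in E(G)}[\sigma_G(u)+\sigma_G(v)]$ and $S_2(G)=\sum_{uv\in E(G)}\sigma_G(u)\sigma_G(v)$. The status co-indices are $\overline{S_1}(G)=\sum_{uv\notin E(G)}[\sigma_G(u)+\sigma_G(v)]$ and $\overline{S_2}(G)=\sum_{uv\notin E(G)}\sigma_G(u)\sigma_G(v)$, where the sums over $uv\notin E(G)$ range over unordered pairs of distinct non-adjacent vertices. *)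

(* Defs.v *)
From mathcomp Require Import all_boot all_order all_algebra.

Set Implicit Arguments.
Unset Strict Implicit.
Unset Printing Implicit Defensive.

Record sgraph := SGraph {
  vertex :> finType;
  adj : rel vertex;
  adj_sym : symmetric adj;
  adj_irrefl : irreflexive adj
}.

Definition connected (G : sgraph) : Prop := forall u v : G, connect (@adj G) u v.

Section Indices.

Variable G : sgraph.
Implicit Types u v : G.

Definition walk_of_length u v (k : nat) : bool :=
  [exists p : k.-tuple G, path (@adj G) u p && (last u p == v)].

(* The least k < #|G| such that u and v are joined by a walk of length k.
   The bound #|G| loses nothing since a shortest walk has no repeated vertex;
   see [distP]. Vertices that are not connected get the dummy value #|G|. *)
Definition dist u v : nat := find (walk_of_length u v) (iota 0 #|G|).

Definition status u : nat := \sum_(v : G) dist u v.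

(* Sum of F over the unordered pairs {u, v} of distinct vertices satisfying P.
   Each pair is counted once, through its representative that is increasing in
   the enumeration of G; P and F are meant to be symmetric. *)
Definition sum_pairs (P : rel G) (F : G -> G -> nat) : nat :=
  \sum_(u : G) \sum_(v : G | (enum_rank u < enum_rank v) && P u v) F u v.

Definition wiener : nat := sum_pairs (fun _ _ => true) dist.

Definition S1 : nat :=
  sum_pairs (@adj G) (fun u v => status u + status v).

Definition S2 : nat :=
  sum_pairs (@adj G) (fun u v => status u * status v).

Definition coS1 : nat :=
  sum_pairs (fun u v => ~~ adj u v) (fun u v => status u + status v).

Definition coS2 : nat :=
  sum_pairs (fun u v => ~~ adj u v) (fun u v => status u * status v).

Lemma walkP u v k :
  reflect (exists p, [/\ path (@adj G) u p, last u p = v & size p = k])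
          (walk_of_length u v k).
Proof.
apply: (iffP existsP) => [[p /andP[up /eqP <-]]|[p [up uv sp]]].
  by exists p; rewrite size_tuple.
by exists (Tuple (introT eqP sp)); rewrite /= up uv eqxx.
Qed.

Lemma distP u v : connect (@adj G) u v ->
  walk_of_length u v (dist u v) /\
  forall k, walk_of_length u v k -> dist u v <= k.
Proof.
move=> /connectP[q uq vq].
have has_w : has (walk_of_length u v) (iota 0 #|G|).
  case/shortenP: uq vq => p up Up _ vp; apply/hasP; exists (size p).
    by rewrite mem_iota /= add0n -[(size p).+1]/(size (u :: p)) -(card_uniqP Up) max_card.
  by apply/walkP; exists p.
have lt_d : dist u v < #|G| by rewrite -[X in _ < X](size_iota 0) -has_find.
split=> [|k wk].
  by have := nth_find 0 has_w; rewrite nth_iota.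
rewrite leqNgt; apply/negP => lt_k.
have := before_find 0 lt_k.
by rewrite nth_iota ?(ltn_trans lt_k) // add0n wk.
Qed.

End Indices.

(* Main.v *)
Require Import Defs.
From mathcomp Require Import all_boot all_order all_algebra.
From mathcomp Require Import ring.

(** The sum over the non-edges is the sum over all pairs minus the sum over the
    edges, and for a symmetric [F] twice the sum over all pairs is the full
    double sum minus its diagonal. For [status u + status v] and
    [status u * status v] the double sum is evaluated with
    [\sum_u status u = 2 * wiener]. *)

Section Pairs.

Variable G : sgraph.
Implicit Types (u v : G) (P : rel G) (F : G -> G -> nat).

Lemma walk_of_lengthC u v k : walk_of_length u v k = walk_of_length v u k.
Proof.
suff rev_walk : forall x y : G, walk_of_length x y k -> walk_of_length y x k.
  by apply/idP/idP; apply: rev_walk.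
(* The reversed walk starts at [last x p], so its remaining vertices are those of [x :: p] without
   the last one, in reverse order. *)
move=> x y /walkP[p [xp <- sp]]; apply/walkP; exists (rev (belast x p)); split.
- by rewrite rev_path (eq_path (e' := @adj G)) // => a b; rewrite adj_sym.
- by case: p {xp sp} => // a p; rewrite /= rev_cons last_rcons.
- by rewrite size_rev size_belast.
Qed.

Lemma distC u v : dist u v = dist v u.
Proof. by apply: eq_find => k; apply: walk_of_lengthC. Qed.

Lemma dist0 u : dist u u = 0.
Proof.
have walk0 : walk_of_length u u 0 by apply/walkP; exists [::].
have : 0 < #|G| by apply/card_gt0P; exists u.
by rewrite /dist; case: #|G| => // m _; rewrite /= walk0.
Qed.

Lemma sum_pairs_compl P F :
  sum_pairs P F + sum_pairs (fun u v => ~~ P u v) F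
  = sum_pairs (fun _ _ => true) F.
Proof.
rewrite /sum_pairs -big_split; apply: eq_bigr => u _ /=.
under [RHS]eq_bigl do rewrite andbT.
by rewrite [RHS](bigID (P u)).
Qed.

Lemma sum_pairs_double F : (forall u v, F u v = F v u) ->
  \sum_u \sum_v F u v = 2 * sum_pairs (fun _ _ => true) F + \sum_u F u u.
Proof.
move=> FC; rewrite mul2n -addnn.
(* Exchanging the two summations and using [FC] turns the second copy into the sum over the
   decreasing pairs. *)
rewrite [X in (_ + X + _)%N](_ : _ =
    \sum_u \sum_(v | enum_rank v < enum_rank u) F u v); last first.
  rewrite /sum_pairs (exchange_big_dep xpredT) //=; apply: eq_bigr => u _.
  by apply: eq_big => v; rewrite ?andbT.
rewrite -!big_split; apply: eq_bigr => u _ /=.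
rewrite (bigID (fun v => enum_rank u < enum_rank v)) /= -addnA.
congr (_ + _); first by apply: eq_bigl => v; rewrite andbT.
(* Among the [v] not above [u], the term [v = u] is the diagonal; the others lie strictly below
   since [enum_rank] is injective. *)
rewrite (bigD1 u) ?ltnn //= addnC; congr (_ + _).
apply: eq_bigl => v; rewrite -leqNgt ltn_neqAle andbC.
by congr (_ && _); rewrite -(inj_eq enum_rank_inj).
Qed.

Lemma sum_status : \sum_(u : G) status u = 2 * wiener G.
Proof.
rewrite sum_pairs_double; last exact: distC.
by rewrite [X in (_ + X)%N]big1 ?addn0 // => u _; apply: dist0.
Qed.

(** Each status occurs [#|G|] times in either position of the double sum and twice on the diagonal,
    so a common factor 2 cancels. The additive form avoids truncated subtraction in [nat]. *)
Lemma S1_coS1 : S1 G + coS1 G + 2 * wiener G = #|G| * (2 * wiener G).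
Proof.
have := @sum_pairs_double (fun u v => status u + status v)
  (fun u v => addnC _ _).
rewrite big_split /= -sum_status -(sum_pairs_compl (@adj G)) addnn -mul2n.
under eq_bigr do rewrite big_split sum_nat_const /=.
rewrite big_split sum_nat_const -big_distrr /= -!mulnDr.
rewrite addnn -mul2n mulnCA => /eqP.
by rewrite eqn_pmul2l // => /eqP <-.
Qed.

(** The square of the total status expands into the double sum of the products, whose diagonal
    consists of the squares. *)
Lemma S2_coS2 :
  2 * (S2 G + coS2 G) + \sum_(u : G) status u ^ 2 = (2 * wiener G) ^ 2.
Proof.
rewrite -sum_status -mulnn big_distrlr /=.
rewrite sum_pairs_double; last by move=> u v; rewrite mulnC.
by rewrite -(sum_pairs_compl (@adj G)).
Qed.

End Pairs.

Local Open Scope ring_scope.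
Import GRing.Theory.

Theorem proposition2p1 (G : sgraph) (n : nat) (hn : #|G| = n)
    (hG : connected G) :
  (coS1 G)%:R = 2 * (n%:R - 1) * (wiener G)%:R - (S1 G)%:R :> rat
  /\
  (coS2 G)%:R = 2 * (wiener G)%:R ^+ 2
    - 1 / 2 * \sum_(u : G) (status u)%:R ^+ 2 - (S2 G)%:R :> rat.
Proof.
split.
- have /(congr1 (fun m => m%:R : rat)) := S1_coS1 G.
  rewrite hn !(natrD, natrM) => e.
  apply: (addrI (S1 G)%:R); apply: (addIr (2 * (wiener G)%:R)).
  by rewrite e; ring.
- have /(congr1 (fun m => m%:R : rat)) := S2_coS2 G.
  rewrite natrX !(natrD, natrM) natr_sum.
  under eq_bigr do rewrite natrX.
  set s := \sum_u _ => e.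
  (* Solving [e] for the sum of squares leaves an identity in [wiener G], [S2 G] and [coS2 G]
     alone. *)
  have -> : s = (2 * (wiener G)%:R) ^+ 2 - 2 * ((S2 G)%:R + (coS2 G)%:R).
    by rewrite -e; ring.
  by field.
Qed.
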